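(* Fix integers $r\ge1$, $g\ge1$, $n\ge1$, non-negative integers $m_2,\dots,m_n$ and $a_2,\dots,a_n\in\{0,\dots,r\}$, and for $j\ge0$ and $d\in\mathbb Z$ let $b_j,e_j,k(d),\delta$ be as defined in the context. Let $\tilde W=(\tilde W_{d,j})_{d\ge\delta,\,j\ge0}$ be the matrix whose entry $\tilde W_{d,j}$ is the $z^j$-coefficient of the formal power series $$\frac{\prod_{i=0}^{k(d)}\left(1+\left(\frac{3-r}{2r+2}+\frac{i}{r+1}\right)z\right)}{(1+(d-e_j)z)^{b_j+1}\prod_{i=0}^{d-e_j-1}(1+iz)^{r+1}}.$$ Pick $N$ distinct integers $d_0,\dots,d_{N-1}$ with $d_i\ge\delta$ for all $i$. Then the determinant of the $N\times N$ submatrix of $\tilde W$ obtained by picking the first $N$ columns (i.e. $j=0,\dots,N-1$) of rows $d_0,\dots,d_{N-1}$ is equal to $$\frac{\prod_{i>j}(d_i-d_j)}{\prod_{i=1}^{N-1}i!}\cdot\prod_{i=1}^{N-1}\left(i+\frac12\right)^{N-i}.$$ In particular, this determinant is never zero.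
   Context: For $j\ge0$, the integers $b_j,e_j$ with $0\le b_j\le r$ are uniquely determined by $(r+1)e_j+(r-3)(1-g)+n=j+b_j+\sum_{i=2}^n(m_i+a_i)$. For an integer $d$, $k(d)=d(r+1)+(r-3)(1-g)+n-1-\sum_{i=2}^n(m_i+a_i)$, and $\delta$ is the smallest $d$ with $k(d)>0$. (Thus $k(d)+1=j+b_j+(d-e_j)(r+1)$ for all $d,j$.) Product convention: if $i_1>i_2$, then $\prod_{i=i_1}^{i_2}A_i$ is defined to be $\prod_{i=i_2+1}^{i_1-1}A_i^{-1}$ (so in particular it is $1$ if $i_1=i_2+1$). *)

(* Defs.v *)
From HB Require Import structures.
From mathcomp Require Import all_boot all_order all_algebra.
From mathcomp Require Import boolp.

Set Implicit Arguments.
Unset Strict Implicit.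
Unset Printing Implicit Defensive.

Import Order.TTheory GRing.Theory Num.Theory.
Local Open Scope ring_scope.

(* Formal power series over a field, as a commutative ring with inverses: the
   product is the Cauchy product, and the units are the series whose constant
   coefficient is nonzero.  A record is used so that this ring structure is
   never confused with a pointwise one on [nat -> K]. *)
Record fps (K : fieldType) := Fps { coefs : nat -> K }.

HB.instance Definition _ (K : fieldType) := [isNew for @coefs K].
HB.instance Definition _ (K : fieldType) := [Choice of fps K by <:].

Section FpsRing.
Variable K : fieldType.
Implicit Types x y z : fps K.

Lemma fpsP x y : (forall n, coefs x n = coefs y n) -> x = y.
Proof. by case: x y => [f] [h] /= fh; congr Fps; apply/funext. Qed.

Definition fps_of_poly (p : {poly K}) : fps K := Fps (fun n => p`_n).

Definition fps_add x y : fps K := Fps (fun n => coefs x n + coefs y n).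
Definition fps_opp x : fps K := Fps (fun n => - coefs x n).
Definition fps_mul x y : fps K :=
  Fps (fun n => \sum_(i < n.+1) coefs x i * coefs y (n - i)%N).

Fact fps_addA : associative fps_add.
Proof. by move=> x y z; apply: fpsP => n /=; rewrite addrA. Qed.
Fact fps_addC : commutative fps_add.
Proof. by move=> x y; apply: fpsP => n /=; rewrite addrC. Qed.
Fact fps_add0 : left_id (fps_of_poly 0) fps_add.
Proof. by move=> x; apply: fpsP => n /=; rewrite coef0 add0r. Qed.
Fact fps_addN : left_inverse (fps_of_poly 0) fps_opp fps_add.
Proof. by move=> x; apply: fpsP => n /=; rewrite coef0 addNr. Qed.

HB.instance Definition _ :=
  GRing.isZmodule.Build (fps K) fps_addA fps_addC fps_add0 fps_addN.

Let trunc n x : {poly K} := \poly_(i < n.+1) coefs x i.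

Let truncE n x i : (i <= n)%N -> (trunc n x)`_i = coefs x i.
Proof. by move=> le_in; rewrite coef_poly ltnS le_in. Qed.

Let trunc_mul n x y i : (i <= n)%N ->
  coefs (fps_mul x y) i = (trunc n x * trunc n y)`_i.
Proof.
move=> le_in; rewrite coefM; apply: eq_bigr => j _.
by rewrite !truncE // ?(leq_trans (leq_subr _ _)) // (leq_trans _ le_in) // -ltnS.
Qed.

Fact fps_mulA : associative fps_mul.
Proof.
move=> x y z; apply: fpsP => n.
transitivity ((trunc n x * (trunc n y * trunc n z))`_n).
  rewrite coefM; apply: eq_bigr => j _.
  by rewrite (@trunc_mul n) ?leq_subr // truncE // -ltnS.
rewrite mulrA coefM; apply: eq_bigr => j _.
by rewrite (@trunc_mul n) -1?ltnS // truncE // leq_subr.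
Qed.
Fact fps_mulC : commutative fps_mul.
Proof. by move=> x y; apply: fpsP => n; rewrite !(@trunc_mul n) // mulrC. Qed.
Fact fps_mul1 : left_id (fps_of_poly 1) fps_mul.
Proof.
move=> x; apply: fpsP => n /=; rewrite big_ord_recl /= coef1 mul1r subn0.
by rewrite big1 ?addr0 // => i _; rewrite coef1 mul0r.
Qed.
Fact fps_mulD : left_distributive fps_mul +%R.
Proof.
move=> x y z; apply: fpsP => n /=; rewrite -big_split /=.
by apply: eq_bigr => i _; rewrite mulrDl.
Qed.
Fact fps_1neq0 : fps_of_poly 1 != 0.
Proof.
apply/eqP => /(congr1 (fun x => coefs x 0)) /=.
by rewrite coef1 coef0; apply/eqP/oner_neq0.
Qed.

HB.instance Definition _ := GRing.Zmodule_isComNzRing.Build (fps K)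
  fps_mulA fps_mulC fps_mul1 fps_mulD fps_1neq0.

(* [fps_inv_coefs x n] lists the first n coefficients of the inverse of x,
   computed by the usual recursion. *)
Fixpoint fps_inv_coefs x (n : nat) : seq K :=
  if n is n'.+1 then
    let s := fps_inv_coefs x n' in
    rcons s ((coefs x 0)^-1 *
             ((n' == 0%N)%:R - \sum_(i < n') coefs x (n' - i)%N * s`_i))
  else [::].

Definition fps_unit : pred (fps K) := fun x => coefs x 0 != 0.

Definition fps_inv x : fps K :=
  if fps_unit x then Fps (fun n => (fps_inv_coefs x n.+1)`_n) else x.

Let size_inv_coefs x n : size (fps_inv_coefs x n) = n.
Proof. by elim: n => //= n IHn; rewrite size_rcons IHn. Qed.

Let nth_inv_coefs x n i : (i < n)%N ->
  (fps_inv_coefs x n)`_i = (fps_inv_coefs x i.+1)`_i.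
Proof.
elim: n => // n IHn; rewrite ltnS leq_eqVlt => /orP[/eqP -> // | lt_in].
by rewrite [in LHS]/= nth_rcons size_inv_coefs lt_in IHn.
Qed.

Fact fps_mulVr : {in fps_unit, left_inverse 1 fps_inv *%R}.
Proof.
move=> x ux; apply: fpsP => n; rewrite /fps_inv (_ : fps_unit x) //= coef1.
rewrite big_ord_recr /= subnn nth_rcons size_inv_coefs ltnn eqxx.
rewrite mulrAC mulVf // mul1r addrC -[RHS]addr0 -addrA; congr (_ + _).
rewrite addrC; apply/eqP; rewrite subr_eq0; apply/eqP.
apply: eq_bigr => i _; rewrite mulrC; congr (_ * _).
by rewrite [RHS]nth_inv_coefs.
Qed.

Fact fps_unitPl x y : y * x = 1 -> fps_unit x.
Proof.
move=> /(congr1 (fun w => coefs w 0)) /=; rewrite big_ord1 coef1 /= => yx.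
apply/eqP => x0; move: yx; rewrite subnn x0 mulr0 => /esym/eqP.
by rewrite oner_eq0.
Qed.

Fact fps_inv_out : {in [predC fps_unit], fps_inv =1 id}.
Proof. by move=> x /negPf xNu; rewrite /fps_inv [fps_unit x]xNu. Qed.

HB.instance Definition _ := GRing.ComNzRing_hasMulInverse.Build (fps K)
  fps_mulVr fps_unitPl fps_inv_out.

End FpsRing.

(* The product of the A i for i from i1 to i2, where for i1 > i2 it is the
   product of the (A i)^-1 for i from i2 + 1 to i1 - 1. *)
Definition prodz (R : comUnitRingType) (i1 i2 : int) (A : int -> R) : R :=
  if i1 <= i2
  then \prod_(0 <= l < absz (i2 - i1 + 1)%R) A (i1 + l%:Z)
  else \prod_(0 <= l < absz (i1 - i2 - 1)%R) (A (i2 + 1 + l%:Z))^-1.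

(* The series 1 + c z. *)
Definition fps_lin (c : rat) : fps rat := fps_of_poly (1 + c *: 'X).

Definition sum_ma (n : nat) (m a : nat -> nat) : nat :=
  (\sum_(2 <= i < n.+1) (m i + a i))%N.

Definition is_be (r g n : nat) (m a b : nat -> nat) (e : nat -> int) : Prop :=
  forall j : nat, (b j <= r)%N /\
    r.+1%:Z * e j + (r%:Z - 3) * (1 - g%:Z) + n%:Z
      = j%:Z + (b j)%:Z + (sum_ma n m a)%:Z.

Definition k_of (r g n : nat) (m a : nat -> nat) (d : int) : int :=
  d * r.+1%:Z + (r%:Z - 3) * (1 - g%:Z) + n%:Z - 1 - (sum_ma n m a)%:Z.

Definition is_delta (r g n : nat) (m a : nat -> nat) (delta : int) : Prop :=
  0 < k_of r g n m a delta /\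
  forall d : int, 0 < k_of r g n m a d -> delta <= d.

Definition Wseries (r g n : nat) (m a b : nat -> nat) (e : nat -> int)
    (d : int) (j : nat) : fps rat :=
  prodz 0 (k_of r g n m a d)
    (fun i => fps_lin ((3 - r%:R) / (2 * r%:R + 2) + i%:~R / r.+1%:R))
  / (fps_lin (d - e j)%:~R ^+ (b j).+1
     * prodz 0 (d - e j - 1) (fun i => fps_lin i%:~R ^+ r.+1)).

Definition Wtilde (r g n : nat) (m a b : nat -> nat) (e : nat -> int)
    (d : int) (j : nat) : rat :=
  coefs (Wseries r g n m a b e d j) j.

(* Main.v *)
(* For a fixed column j, the entry of row d is a polynomial in d of degree at
   most j whose d^j-coefficient is binom(j + 1/2, j); the determinant is then
   the Vandermonde determinant times the product of these coefficients.  To see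
   this, note that the series F(d) satisfies F(d + 1) = F(d) X(d), where X(d) is
   a product of factors (1 + (d + y) z) / (1 + (d + x) z), whose differences
   y - x add up to j + 1/2.  Each z^(m+1)-coefficient of X(d) is thus a
   polynomial of degree at most m in d with top coefficient (j + 1/2) (-1)^m, and
   discrete integration gives, by induction on m, that the z^m-coefficient of
   F(d) is a polynomial of degree at most m in d with top coefficient
   binom(j + 1/2, m). *)

Require Import Defs.
From mathcomp Require Import all_boot all_order all_algebra.
From mathcomp Require Import ring lra zify.

Import Order.TTheory GRing.Theory Num.Theory.
Local Open Scope ring_scope.

(** * Polynomial functions on the integers with a degree bound and a prescribed coefficient *)

(** The coefficient [c] in degree [m] may vanish, so [polyfun m 0 f] expresses that [f] has degree
    less than [m]. *)
Definition polyfun (m : nat) (c : rat) (f : int -> rat) : Prop :=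
  exists p : {poly rat},
    [/\ (size p <= m.+1)%N, p`_m = c & forall x : int, f x = p.[x%:~R]].

Lemma eq_polyfun {m c f} c' f' :
  polyfun m c f -> c = c' -> f =1 f' -> polyfun m c' f'.
Proof. by move=> [p [? ? fp]] <- ff'; exists p; split=> // x; rewrite -ff'. Qed.

Lemma polyfun_cst c : polyfun 0 c (fun=> c).
Proof.
by exists c%:P; split=> [||x]; rewrite ?size_polyC_leq1 ?coefC ?hornerC.
Qed.

Lemma polyfun_shift (y : rat) : polyfun 1 1 (fun x => x%:~R + y).
Proof.
exists ('X + y%:P); split=> [||x]; last by rewrite !hornerE.
  by rewrite size_XaddC.
by rewrite coefD coefX coefC addr0.
Qed.

Lemma polyfunD {m c c' f f'} : polyfun m c f -> polyfun m c' f' ->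
  polyfun m (c + c') (fun x => f x + f' x).
Proof.
move=> [p [sp <- fp]] [q [sq <- fq]]; exists (p + q).
split=> [||x]; rewrite ?coefD ?hornerD ?fp ?fq //.
by rewrite (leq_trans (size_polyD _ _)) // geq_max sp.
Qed.

Lemma polyfunM {m c f m' c' f'} : polyfun m c f -> polyfun m' c' f' ->
  polyfun (m + m') (c * c') (fun x => f x * f' x).
Proof.
move=> [p [sp <- fp]] [q [sq <- fq]]; exists (p * q).
split=> [||x]; last by rewrite hornerM fp fq.
  by rewrite (leq_trans (size_polyMleq _ _)) // -ltnS; lia.
have lt_m : (m < (m + m').+1)%N by rewrite ltnS leq_addr.
(* Only the index [m] contributes: any other one exceeds the degree bound of [p] or of [q]. *)
rewrite coefM (bigD1 (Ordinal lt_m)) //= addKn big1 ?addr0 // => i.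
rewrite -val_eqE /= => i_m; have [lt_im|lt_mi|/eqP] := ltngtP i m.
- by rewrite [q`__]nth_default ?mulr0 // (leq_trans sq) //; lia.
- by rewrite [p`__]nth_default ?mul0r // (leq_trans sp).
- by rewrite (negPf i_m).
Qed.

Lemma polyfunZ {m c f} a : polyfun m c f -> polyfun m (a * c) (fun x => a * f x).
Proof. exact: (polyfunM (polyfun_cst a)). Qed.

Lemma polyfunX {m c f} n :
  polyfun m c f -> polyfun (m * n) (c ^+ n) (fun x => f x ^+ n).
Proof.
move=> fP; elim: n => [|n IHn]; first by rewrite muln0; apply: polyfun_cst.
rewrite mulnS; apply: eq_polyfun (polyfunM fP IHn) _ _ => [|x];
  by rewrite exprS.
Qed.

Lemma polyfunW {m c f} : polyfun m c f -> polyfun m.+1 0 f.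
Proof.
by move=> [p [sp _ fp]]; exists p; split=> //; [apply: leqW|rewrite nth_default].
Qed.

Lemma polyfun_lower m f : polyfun m.+1 0 f -> exists c, polyfun m c f.
Proof.
move=> [p [sp p0 fp]]; exists p`_m, p; split=> //.
rewrite leqNgt; apply/negP=> lt_p.
have size_p : size p = m.+2 by apply/eqP; rewrite eqn_leq sp lt_p.
have := lead_coef_eq0 p; rewrite lead_coefE size_p p0 eqxx => /esym/eqP p00.
by rewrite p00 size_poly0 in size_p.
Qed.

Lemma polyfun_sum {n m} (c : nat -> rat) (f : nat -> int -> rat) :
  (forall i, (i < n)%N -> polyfun m (c i) (f i)) ->
  polyfun m (\sum_(i < n) c i) (fun x => \sum_(i < n) f i x).
Proof.
elim: n => [|n IHn] fP.
  exists 0; split=> [||x]; rewrite ?size_poly0 ?coef0 ?horner0 ?big_ord0 //.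
have := polyfunD (IHn (fun i lt_in => fP i (ltnW lt_in))) (fP n (ltnSn n)).
by move/eq_polyfun; apply=> [|x]; rewrite big_ord_recr.
Qed.

(** * Finite differences and discrete integration *)

Lemma polyfun_diffX m :
  polyfun m m.+1%:R (fun x => (x + 1)%:~R ^+ m.+1 - x%:~R ^+ m.+1).
Proof.
elim: m => [|m IHm].
  apply: eq_polyfun (polyfun_cst 1) _ _ => // x.
  by rewrite !expr1 intrD addrAC subrr add0r.
have X1 := polyfun_shift 1.
have Xm := polyfunX m.+1 (polyfun_shift 0).
rewrite mul1n in Xm.
(* Uses (x+1)^(m+2) - x^(m+2) = (x+1)((x+1)^(m+1) - x^(m+1)) + x^(m+1). *)
apply: (eq_polyfun _ _ (polyfunD (polyfunM X1 IHm) Xm)) => [|x].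
  by rewrite expr1n mul1r -[RHS]natr1.
rewrite addr0 intrD [(_ + _) ^+ m.+2]exprS [_ ^+ m.+2]exprS.
by move: (_ ^+ m.+1) (_ ^+ m.+1) => u v; ring.
Qed.

Lemma int_fun_const (T : Type) (f : int -> T) :
  (forall x, f (x + 1) = f x) -> forall x, f x = f 0.
Proof.
move=> fS; elim/int_ind=> [//|n IHn|n IHn].
  by rewrite -addn1 PoszD fS.
by rewrite -IHn -fS; congr f; lia.
Qed.

(** Subtracting a suitable multiple of x^(m+1) from [f] kills the top coefficient of the difference,
    and induction on the degree applies. In degree 0, [f x - c * x] is 1-periodic, hence
    constant. *)
Lemma polyfun_antidiff {m c} (f : int -> rat) :
  polyfun m c (fun x => f (x + 1) - f x) -> polyfun m.+1 (c / m.+1%:R) f.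
Proof.
elim: m c f => [|m IHm] c f fP.
  have [p [sp pc fp]] := fP.
  have fD x : f (x + 1) - f x = c.
    by rewrite fp (size1_polyC sp) hornerC pc.
  have cst := int_fun_const _ (fun x : int => f x - c * x%:~R).
  apply: (eq_polyfun _ _ (polyfunD
    (polyfunZ c (polyfun_shift 0)) (polyfunW (polyfun_cst (f 0))))).
    by rewrite mulr1 addr0.
  move=> x /=; have := cst _ x; rewrite mulr0 subr0 => <-; first by ring.
  by move=> y; rewrite intrD -(fD y); ring.
(* The difference of [a * x ^ (m+2)] has top coefficient [a * (m+2) = c]. *)
set a := c / m.+2%:R.
have hP := polyfunZ a (polyfunX m.+2 (polyfun_shift 0)).
have hD := polyfunZ (- a) (polyfun_diffX m.+1).
have [|c' dP] := polyfun_lower m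
   (fun x => (f (x + 1) - a * (x + 1)%:~R ^+ m.+2) - (f x - a * x%:~R ^+ m.+2)).
  apply: (eq_polyfun _ _ (polyfunD fP hD)) => [|x]; last by ring.
  by rewrite mulNr divfK ?subrr // pnatr_eq0.
have := polyfunW (IHm _ (fun x => f x - a * x%:~R ^+ m.+2) dP).
rewrite mul1n in hP; move/polyfunD/(_ hP)/eq_polyfun; apply=> [|x].
  by rewrite expr1n mulr1 add0r.
by rewrite addr0 subrK.
Qed.

(** * Series of the type of the ratio X(d), and the recurrence they drive *)

(* To leading order in [x] in each coefficient, [X x] agrees with
   [1 + s z / (1 + x z)]. *)
Definition near1 (s : rat) (X : int -> fps rat) : Prop :=
  (forall x, coefs (X x) 0 = 1) /\
  (forall m, polyfun m (s * (-1) ^+ m) (fun x => coefs (X x) m.+1)).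

Lemma eq_near1 {s X} s' X' : near1 s X -> s = s' -> X =1 X' -> near1 s' X'.
Proof.
move=> [X0 XP] <- eqX; split=> [x|m]; first by rewrite -eqX.
by apply: eq_polyfun (XP m) _ _ => // x; rewrite eqX.
Qed.

Lemma near1_one : near1 0 (fun=> 1).
Proof.
split=> [x|m]; first by rewrite /= coef1.
exists 0; split=> [||x]; rewrite ?size_poly0 ?coef0 ?mul0r //.
by rewrite horner0 /= coef1.
Qed.

Lemma near1M {s X s' X'} : near1 s X -> near1 s' X' ->
  near1 (s + s') (fun x => X x * X' x).
Proof.
move=> [X0 XP] [Y0 YP]; split=> [x|m].
  by rewrite /= big_ord1 X0 Y0 mulr1.
(* Apart from the two end terms, the products have degree i + (m-i-1) = m-1, too small to affect the
   coefficient in degree m. *)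
have midP : polyfun m 0
    (fun x => \sum_(i < m) coefs (X x) i.+1 * coefs (X' x) (m - i)%N).
  have := polyfun_sum (n := m) (m := m) (fun=> 0)
    (fun i x => coefs (X x) i.+1 * coefs (X' x) (m - i)%N).
  move=> H; apply: (eq_polyfun _ _ (H _)) => [i lt_im||//]; last by rewrite big1.
  have -> : (m - i = (m - i.+1).+1)%N by lia.
  have := polyfunW (polyfunM (XP i) (YP (m - i.+1)%N)).
  by have -> : (i + (m - i.+1)).+1 = m by lia.
apply: (eq_polyfun _ _ (polyfunD (polyfunD (XP m) (YP m)) midP)).
  by rewrite addr0 mulrDl.
move=> x /=; rewrite big_ord_recr big_ord_recl /= subn0 subnn X0 Y0 mul1r mulr1.
by rewrite [RHS]addrC addrA.
Qed.

Lemma near1_prod n (s : nat -> rat) (X : nat -> int -> fps rat) :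
  (forall i, near1 (s i) (X i)) ->
  near1 (\sum_(i < n) s i) (fun x => \prod_(i < n) X i x).
Proof.
move=> XP; elim: n => [|n IHn].
  by apply: eq_near1 near1_one _ _ => [|x]; rewrite big_ord0.
by apply: eq_near1 (near1M IHn (XP n)) _ _ => [|x]; rewrite big_ord_recr.
Qed.

Lemma fps_lin_coefs0 x : coefs (fps_lin x) 0 = 1.
Proof. by rewrite /= coefD coef1 coefZ coefX mulr0 addr0. Qed.

Lemma fps_unitE (K : fieldType) (x : fps K) :
  (x \is a GRing.unit) = (coefs x 0 != 0).
Proof. by []. Qed.

Lemma fps_lin_unit x : fps_lin x \is a GRing.unit.
Proof. by rewrite fps_unitE fps_lin_coefs0 oner_neq0. Qed.

(** Geometric series, from 1 + yz = (1 + xz) + (y-x)z. *)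
Lemma fps_lin_divE x y :
  fps_lin y / fps_lin x =
    Fps (fun m => if m is m'.+1 then (y - x) * (- x) ^+ m' else 1).
Proof.
apply: (mulIr (fps_lin_unit x)); rewrite divrK ?fps_lin_unit //.
apply: fpsP => -[|m] /=.
  by rewrite big_ord1 !coefE /=; ring.
rewrite big_ord_recr /= subnn big_ord_recr /= subSnn.
rewrite !coefE /= eqSS.
rewrite big1; last first.
  move=> i _; rewrite (_ : (m.+1 - i)%N = (m - i.+1).+2).
    2: by have := ltn_ord i; lia.
  by rewrite !coefE /= mulr0 addr0 mulr0.
case: m => [|m] /=; first by rewrite expr0; ring.
by rewrite exprS; ring.
Qed.

Lemma near1_lin_div y y' :
  near1 (y' - y) (fun x => fps_lin (x%:~R + y') / fps_lin (x%:~R + y)).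
Proof.
split=> [x|m]; first by rewrite fps_lin_divE.
have := polyfunZ (y' - y) (polyfunX m
  (polyfunZ (-1) (polyfun_shift y))).
rewrite mul1n => /eq_polyfun; apply=> [|x]; first by rewrite mulr1.
by rewrite fps_lin_divE /= mulN1r; congr (_ * _); ring.
Qed.

(* The generalized binomial coefficient, the leading coefficient in [x] of the
   z^m-coefficient of [(1 + x z) ^ alpha]. *)
Definition gbin (alpha : rat) (m : nat) : rat :=
  \prod_(i < m) ((alpha - i%:R) / i.+1%:R).

(** Coefficient of z^m in the identity ((1+z)^alpha)' = alpha (1+z)^alpha / (1+z). *)
Lemma gbin_alternating alpha m :
  \sum_(k < m.+1) gbin alpha k * (alpha * (-1) ^+ (m - k))
    = m.+1%:R * gbin alpha m.+1.
Proof.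
elim: m => [|m IHm].
  by rewrite big_ord1 /gbin /= big_ord0 big_ord1 /=; field.
rewrite big_ord_recr /= subnn expr0 mulr1.
have -> : \sum_(i < m.+1) gbin alpha i * (alpha * (-1) ^+ (m.+1 - i)) =
    - (m.+1%:R * gbin alpha m.+1).
  rewrite -IHm -sumrN; apply: eq_bigr => i _.
  by rewrite subSn -1?ltnS // exprS; ring.
rewrite {3}/gbin big_ord_recr /= -/(gbin alpha m.+1).
have m2 : m.+2%:R != 0 :> rat by rewrite pnatr_eq0.
by rewrite mulrCA [X in _ = _ * X]mulrCA mulfV // mulr1; ring.
Qed.

Lemma near1_recurrence alpha (X F : int -> fps rat) :
    near1 alpha X -> (forall x, coefs (F x) 0 = 1) ->
    (forall x, F (x + 1) = F x * X x) ->
  forall m, polyfun m (gbin alpha m) (fun x => coefs (F x) m).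
Proof.
move=> [X0 XP] F0 FS; elim/ltn_ind=> -[_|m IHm].
  by apply: eq_polyfun (polyfun_cst 1) _ _ => [|x]; rewrite ?F0 // /gbin big_ord0.
have H := polyfun_sum (n := m.+1) (m := m) (fun k => gbin alpha k * (alpha * (-1) ^+ (m - k)))
  (fun k x => coefs (F x) k * coefs (X x) (m - k).+1).
have {}H : polyfun m (m.+1%:R * gbin alpha m.+1)
    (fun x => coefs (F (x + 1)) m.+1 - coefs (F x) m.+1).
  rewrite -gbin_alternating; apply: (eq_polyfun _ _ (H _)) => // [i lt_im|x].
    have := polyfunM (IHm i lt_im) (XP (m - i)%N).
    by rewrite subnKC // -ltnS.
  (* The last term of the Cauchy product is the coefficient of [F x] itself, since [X x] has
     constant coefficient 1; it cancels. *)
  rewrite FS /= [in RHS]big_ord_recr /= subnn X0 mulr1 addrK.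
  by apply: eq_bigr => i _; rewrite subSn // -ltnS.
apply: eq_polyfun (polyfun_antidiff _ H) _ _ => //.
by rewrite mulrAC mulfV ?mul1r // pnatr_eq0.
Qed.

(** The matrix is a Vandermonde matrix times the triangular matrix of coefficients, whose diagonal
    is formed by the [c j]. *)
Lemma det_polyfun N (f : nat -> int -> rat) (c : nat -> rat) (d : 'I_N -> int) :
    (forall j, polyfun j (c j) (f j)) ->
  \det (\matrix_(i < N, j < N) f j (d i)) =
    (\prod_(i < N) \prod_(j < N | (j < i)%N) (d i - d j)%:~R) * \prod_(j < N) c j.
Proof.
move=> fP; have /fin_all_exists[p pP] : forall j : 'I_N, exists p : {poly rat},
    [/\ (size p <= j.+1)%N, p`_j = c j & forall x : int, f j x = p.[x%:~R]].
  by move=> j; apply: fP.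
pose V := Vandermonde N (\row_(i < N) (d i)%:~R) : 'M[rat]_N.
pose U : 'M[rat]_N := \matrix_(j, k) (p j)`_k.
have -> : \matrix_(i < N, j < N) f j (d i) = (U *m V)^T.
  apply/matrixP=> i j; rewrite !mxE; have [sp _ ->] := pP j.
  rewrite (horner_coef_wide _ (leq_trans sp (ltn_ord j))).
  by apply: eq_bigr => k _; rewrite !mxE.
rewrite det_tr det_mulmx mulrC det_Vandermonde det_trig; last first.
  apply/is_trig_mxP=> i j lt_ij; rewrite mxE nth_default //.
  by have [sp _ _] := pP i; apply: leq_trans sp lt_ij.
congr (_ * _); last by apply: eq_bigr => j _; rewrite mxE; have [] := pP j.
rewrite (exchange_big_dep predT) //=; apply: eq_bigr => i _.
by apply: eq_bigr => j _; rewrite !mxE intrB.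
Qed.

(** * Products with integer bounds *)

(** The inverse convention makes this hold for every integer [k]: for [k < -1] the new factor
    cancels the inverse at index [k + 1], and [k = -1] gives the empty product. *)
Lemma prodz0_succ (R : comUnitRingType) (A : int -> R) (k : int) :
    (forall i, A i \is a GRing.unit) ->
  prodz 0 (k + 1) A = prodz 0 k A * A (k + 1).
Proof.
move=> uA; rewrite /prodz; case: (ltrP k (-1)) => [lt_k|].
  have [-> ->] : (0 <= k + 1) = false /\ (0 <= k) = false by split; lia.
  have -> : absz (0 - k - 1)%R = (absz (0 - (k + 1) - 1)%R).+1 by lia.
  rewrite [in RHS]big_nat_recl //= addr0 mulrAC mulVr // mul1r.
  by apply: eq_bigr => l _; congr (A _)^-1; lia.
case: (ltrP k 0) => [lt_k0 le_k|le_0k _].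
  have -> : k = -1 by lia.
  by rewrite /= big_nat1 big_geq // mul1r.
rewrite ifT; last by lia.
have -> : absz (k + 1 - 0 + 1)%R = (absz (k - 0 + 1)%R).+1 by lia.
by rewrite big_nat_recr //=; congr (_ * A _); lia.
Qed.

Lemma prodz0_add (R : comUnitRingType) (A : int -> R) (k : int) (n : nat) :
    (forall i, A i \is a GRing.unit) ->
  prodz 0 (k + n%:Z) A = prodz 0 k A * \prod_(l < n) A (k + 1 + l%:Z).
Proof.
move=> uA; elim: n => [|n IHn]; first by rewrite addr0 big_ord0 mulr1.
rewrite -addn1 PoszD addrA prodz0_succ // IHn addn1 big_ord_recr /= mulrA.
by congr (_ * A _); lia.
Qed.

Lemma fps_coefs0M (K : fieldType) (x y : fps K) :
  coefs (x * y) 0 = coefs x 0 * coefs y 0.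
Proof. by rewrite /= big_ord1. Qed.

Lemma fps_coefs0V (K : fieldType) (x : fps K) : coefs x 0 = 1 -> coefs x^-1 0 = 1.
Proof.
move=> x0; have ux : x \is a GRing.unit by rewrite fps_unitE x0 oner_neq0.
have := congr1 (fun y => coefs y 0) (mulrV ux).
by rewrite fps_coefs0M x0 mul1r /= coef1.
Qed.

Lemma fps_coefs0_prod (K : fieldType) (I : Type) (s : seq I) (F : I -> fps K) :
  (forall i, coefs (F i) 0 = 1) -> coefs (\prod_(i <- s) F i) 0 = 1.
Proof.
move=> F0; elim/big_rec: _ => [|i x _ x0]; first by rewrite /= coef1.
by rewrite fps_coefs0M F0 x0 mulr1.
Qed.

Lemma fps_coefs0X (K : fieldType) (x : fps K) n :
  coefs x 0 = 1 -> coefs (x ^+ n) 0 = 1.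
Proof.
by move=> x0; rewrite -[n]card_ord -prodr_const; apply: fps_coefs0_prod.
Qed.

Lemma fps_coefs0_prodz (K : fieldType) (k l : int) (A : int -> fps K) :
  (forall i, coefs (A i) 0 = 1) -> coefs (prodz k l A) 0 = 1.
Proof.
move=> A0; rewrite /prodz; case: ifP => _; apply: fps_coefs0_prod => // i.
exact: fps_coefs0V.
Qed.

(** * The entries of a fixed column as functions of the row index *)

Section Row.
Variables (r g n : nat) (m a b : nat -> nat) (e : nat -> int).
Hypothesis be : is_be r g n m a b e.

Lemma k_of_succ d : k_of r g n m a (d + 1) = k_of r g n m a d + r.+1%:Z.
Proof. by rewrite /k_of; ring. Qed.

Lemma k_ofE d j :
  k_of r g n m a d + 1 = j%:Z + (b j)%:Z + (d - e j) * r.+1%:Z.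
Proof. by have [_] := be j; rewrite /k_of; lia. Qed.

Lemma Wseries_coefs0 d j : coefs (Wseries r g n m a b e d j) 0 = 1.
Proof.
rewrite /Wseries fps_coefs0M fps_coefs0_prodz ?mul1r => [|i]; last first.
  exact: fps_lin_coefs0.
rewrite fps_coefs0V // fps_coefs0M fps_coefs0X ?fps_lin_coefs0 // mul1r.
by apply: fps_coefs0_prodz => i; rewrite fps_coefs0X ?fps_lin_coefs0.
Qed.

(** By [k_ofE], the numerator factor with index k(d) + 1 + l is 1 + (d + y j l) z. *)
Let y j l : rat :=
  (3 - r%:R) / (2 * r%:R + 2) + (j + b j + l)%:R / r.+1%:R - (e j)%:~R.

(** The first product pairs the r+1 new numerator factors with the new denominator factor of
    multiplicity r+1; the second accounts for the change of the power with exponent b_j + 1. *)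
Let ratio j (d : int) : fps rat :=
  (\prod_(l < r.+1) (fps_lin (d%:~R + y j l) / fps_lin (d%:~R + - (e j)%:~R))) *
  \prod_(l < (b j).+1)
    (fps_lin (d%:~R + - (e j)%:~R) / fps_lin (d%:~R + (1 - (e j)%:~R))).

Lemma Wseries_succ d j :
  Wseries r g n m a b e (d + 1) j = Wseries r g n m a b e d j * ratio j d.
Proof.
rewrite /Wseries k_of_succ prodz0_add => [|i]; last exact: fps_lin_unit.
rewrite (k_ofE d j).
have -> : d + 1 - e j - 1 = d - e j - 1 + 1 by ring.
rewrite prodz0_succ => [|i]; last by rewrite unitrX ?fps_lin_unit.
rewrite subrK /ratio !big_split /= !prodr_const !card_ord.
rewrite [(d + 1 - e j)%:~R](_ : _ = d%:~R + (1 - (e j)%:~R)); last first.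
  by rewrite intrB intrD addrA.
rewrite [(d - e j)%:~R]intrB.
under eq_bigr => l _.
  rewrite [X in fps_lin X](_ : _ = d%:~R + y j l); last first.
    rewrite /y !(intrD, intrM, intrB) !natrD -!pmulrn -natr1 /=.
    have := ler0n rat r.
    by move=> r0; field; apply/andP; split; apply: lt0r_neq0; lra.
  over.
set P := prodz _ _ _; set Q := prodz _ _ _; set L' := fps_lin _; set L := fps_lin _.
have uL : L \is a GRing.unit by apply: fps_lin_unit.
have uL' : L' \is a GRing.unit by apply: fps_lin_unit.
have uQ : Q \is a GRing.unit.
  rewrite fps_unitE fps_coefs0_prodz ?oner_neq0 // => i.
  by rewrite fps_coefs0X ?fps_lin_coefs0.
rewrite !exprVn !invrM ?unitrM ?unitrX ?uQ //.
set p := \prod_(l < _) _.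
set Lb := L ^+ (b j).+1; have uLb : Lb \is a GRing.unit by apply: unitrX.
move: (L ^+ r.+1) (L' ^+ _) => x x'.
(* With [Lb / Lb] inserted on the left, both sides agree as monomials in which inverses are
   atoms. *)
rewrite -[LHS](mulrK uLb); ring.
Qed.

(** The first product contributes (3-r)/2 + (j + b_j) + r/2 = j + b_j + 3/2, the second -(b_j +
    1). *)
Lemma near1_ratio j : near1 (j%:R + 1 / 2) (ratio j).
Proof.
have P1 := near1_prod r.+1 _ _ (fun l => near1_lin_div (- (e j)%:~R) (y j l)).
have P2 := near1_prod (b j).+1 _ _
  (fun=> near1_lin_div (1 - (e j)%:~R) (- (e j)%:~R)).
apply: (eq_near1 _ _ (near1M P1 P2)) => //.
have r0 := ler0n rat r.
have -> : \sum_(l < r.+1) (y j l - - (e j)%:~R) = j%:R + (b j)%:R + 3 / 2 :> rat.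
  have suml k : \sum_(l < k) (l%:R : rat) = k%:R * (k%:R - 1) / 2.
    elim: k => [|k IHk]; first by rewrite big_ord0 !mul0r.
    by rewrite big_ord_recr /= IHk -natr1; field.
  under eq_bigr => l _ do rewrite /y opprK subrK natrD [X in _ + X]mulrDl addrA.
  rewrite big_split /= -mulr_suml suml sumr_const card_ord -mulr_natr natrD -natr1.
  by field; apply/andP; split; apply: lt0r_neq0; lra.
by rewrite sumr_const card_ord -[_ *+ (b j).+1]mulr_natr -(natr1 (b j)); field.
Qed.

Lemma polyfun_Wtilde j :
  polyfun j (gbin (j%:R + 1 / 2) j) (fun d => Wtilde r g n m a b e d j).
Proof.
apply: (near1_recurrence _ _ _ (near1_ratio j)) => d; last exact: Wseries_succ.
exact: Wseries_coefs0.
Qed.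

End Row.

(** * The product of the top coefficients *)

Lemma gbin_half j :
  gbin (j%:R + 1 / 2) j = (\prod_(1 <= i < j.+1) (i%:R + 1 / 2)) / j`!%:R.
Proof.
rewrite /gbin big_split /= prodfV; congr (_ / _).
  (* Reversing the order turns the factors j + 1/2 - i into i + 1/2 with 1 <= i <= j. *)
  rewrite big_add1 /= big_mkord (reindex_inj rev_ord_inj) /=.
  apply: eq_bigr => i _.
  by rewrite -[i.+1](subKn (ltn_ord i)) natrB ?leq_subr // subKn //; ring.
by rewrite fact_prod natr_prod big_add1 /= big_mkord.
Qed.

(** The factor i + 1/2 and the factorial [i]: the former occurs for every j from i to N-1, hence N -
    i times; the latter only for j = i. *)
Lemma prod_gbin_half N :
  \prod_(j < N) gbin (j%:R + 1 / 2) j =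
    (\prod_(1 <= i < N) (i%:R + 1 / 2) ^+ (N - i)) / \prod_(1 <= i < N) i`!%:R.
Proof.
elim: N => [|N IHN]; first by rewrite big_ord0 !big_geq // divr1.
rewrite big_ord_recr /= IHN gbin_half.
case: N {IHN} => [|N]; first by rewrite !big_geq // fact0.
rewrite [X in _ = _ / X]big_nat_recr //= invfM mulrACA; congr (_ * _).
rewrite [X in _ * X]big_nat_recr //= [RHS]big_nat_recr //= subSnn expr1 mulrA.
congr (_ * _); rewrite -big_split /=; apply: eq_big_nat => i /andP[_ lt_i].
by rewrite [in RHS]subSn 1?ltnW // exprSr.
Qed.

Theorem proposition3p6 (r g n : nat) (m a b : nat -> nat) (e : nat -> int)
    (delta : int) (N : nat) (d : 'I_N -> int)
    (hr : (1 <= r)%N) (hg : (1 <= g)%N) (hn : (1 <= n)%N)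
    (ha : forall i : nat, (2 <= i <= n)%N -> (a i <= r)%N)
    (hbe : is_be r g n m a b e)
    (hdelta : is_delta r g n m a delta)
    (d_inj : injective d)
    (d_ge : forall i : 'I_N, delta <= d i) :
  let D := \det (\matrix_(i < N, j < N) Wtilde r g n m a b e (d i) j) in
  D = (\prod_(i < N) \prod_(j < N | (j < i)%N) (d i - d j)%:~R)
        / (\prod_(1 <= i < N) i`!%:R)
      * \prod_(1 <= i < N) (i%:R + 1 / 2) ^+ (N - i)
  /\ D != 0.
Proof.
move=> D.
have DE : D = (\prod_(i < N) \prod_(j < N | (j < i)%N) (d i - d j)%:~R)
        / (\prod_(1 <= i < N) i`!%:R)
      * \prod_(1 <= i < N) (i%:R + 1 / 2) ^+ (N - i).
  rewrite /D (det_polyfun _ _ _ d (polyfun_Wtilde _ _ _ _ _ _ _ hbe)).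
  by rewrite prod_gbin_half mulrAC mulrA.
split=> //; rewrite DE !mulf_neq0 ?invr_eq0 //.
- apply/prodf_neq0 => i _; apply/prodf_neq0 => j lt_ji.
  rewrite intr_eq0 subr_eq0 (inj_eq d_inj).
  by apply: contraTneq lt_ji => ->; rewrite ltnn.
- by rewrite prodf_seq_neq0; apply/allP => i _ /=; rewrite pnatr_eq0 -lt0n fact_gt0.
- by rewrite prodf_seq_neq0; apply/allP => i _ /=; rewrite expf_neq0 // gt_eqF // ltr_wpDl.
Qed.
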